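(* Let $\mathbb{F}$ be a field of characteristic not $2$, let $T$ be a finite group, let $\sigma\in Z^2(T,\mathbb{F}^\times)$, and let $\tau:T\to T$ be a map. Then there exists a $\tau$-homogeneous involution on the twisted group algebra $\mathbb{F}^\sigma T$ (with its natural $T$-grading) if and only if $\tau$ is an antiautomorphism of $T$ with $\tau\circ\tau=\mathrm{id}_T$ and the pair $(\sigma,\tau)$ is compatible.
   Context: $Z^2(T,\mathbb{F}^\times)$ is the abelian group (under pointwise multiplication) of 2-cocycles, i.e. maps $\sigma:T\times T\to\mathbb{F}^\times$ with $\sigma(u,v)\sigma(uv,w)=\sigma(u,vw)\sigma(v,w)$ for all $u,v,w\in T$ (no normalization is assumed). The twisted group algebra $\mathbb{F}^\sigma T$ is the associative $\mathbb{F}$-algebra with basis $\{X_u\mid u\in T\}$ and product $X_uX_v=\sigma(u,v)X_{uv}$; its natural $T$-grading has homogeneous component $\mathbb{F}X_u$ in degree $u$. An involution is an $\mathbb{F}$-linear map $\iota$ with $\iota(xy)=\iota(y)\iota(x)$ and $\iota(\iota(x))=x$ for all $x,y$. Given a map $\tau:T\to T$, an involution $\iota$ on a $T$-graded algebra $\mathcal{A}=\bigoplus_{g\in T}\mathcal{A}_g$ is a $\tau$-homogeneous involution if $\iota(\mathcal{A}_g)\subseteq\mathcal{A}_{\tau(g)}$ for all $g\in T$. An antiautomorphism of $T$ is a bijection $\tau:T\to T$ with $\tau(uv)=\tau(v)\tau(u)$. For an antiautomorphism $\tau$, put $(\tau\sigma)(u,v)=\sigma(\tau(v),\tau(u))$.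 For a map $\mu:T\to\mathbb{F}^\times$, put $\delta\mu(u,v)=\mu(u)\mu(v)\mu(uv)^{-1}$. For an antiautomorphism $\tau$, the pair $(\sigma,\tau)$ is compatible if there is a map $\mu:T\to\mathbb{F}^\times$ such that $\sigma=\delta\mu\cdot\tau\sigma$ (pointwise product) and $\mu(u\tau(u))=1$ for all $u\in T$. *)

(* Defs.v *)
From HB Require Import structures.
From mathcomp Require Import all_boot all_order all_algebra all_fingroup all_field.

Set Implicit Arguments.
Unset Strict Implicit.
Unset Printing Implicit Defensive.

Import GRing.Theory.
Local Open Scope ring_scope.

(* Values in the unit group of F are encoded as nonzero elements of F. *)
Record cocycle2 (F : fieldType) (T : finGroupType) := Cocycle2 {
  cocycle2_val :> T -> T -> F;
  cocycle2_neq0 : forall u v, cocycle2_val u v != 0;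
  cocycle2P : forall u v w,
    cocycle2_val u v * cocycle2_val (u * v)%g w =
    cocycle2_val u (v * w)%g * cocycle2_val v w
}.

(* A function x stands for the element \sum_u x u *: X_u. *)
Definition twisted_galg (F : fieldType) (T : finGroupType)
  (sigma : cocycle2 F T) : Type := {ffun T -> F^o}.

Section TwistedGroupAlgebra.
Variables (F : fieldType) (T : finGroupType) (sigma : cocycle2 F T).
Local Notation A := (twisted_galg sigma).

HB.instance Definition _ := Vector.copy A {ffun T -> F^o}.

Definition tw_fun (x : A) : T -> F := fun_of_fin (x : {ffun T -> F^o}).

Definition tw_basis (u : T) : A := [ffun v => (v == u)%:R : F^o].
Local Notation X := tw_basis.

Definition tw_mul (x y : A) : A :=
  \sum_u \sum_v (tw_fun x u * tw_fun y v * sigma u v) *: X (u * v)%g.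

(* As sigma need not be normalized, the unit is not X_1 in general. *)
Definition tw_one : A := (sigma 1%g 1%g)^-1 *: X 1%g.

Lemma tw_funP (x y : A) : tw_fun x =1 tw_fun y -> x = y.
Proof. by move=> e; apply/ffunP. Qed.

Lemma tw_funD x y u : tw_fun (x + y) u = tw_fun x u + tw_fun y u.
Proof. by rewrite /tw_fun ffunE. Qed.

Lemma tw_funZ a x u : tw_fun (a *: x) u = a * tw_fun x u.
Proof. by rewrite /tw_fun ffunE. Qed.

Lemma tw_fun0 u : tw_fun 0 u = 0.
Proof. by rewrite /tw_fun ffunE. Qed.

Lemma tw_fun_sum I (r : seq I) (P : pred I) (E : I -> A) u :
  tw_fun (\sum_(i <- r | P i) E i) u = \sum_(i <- r | P i) tw_fun (E i) u.
Proof.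
by apply: (big_morph (fun x => tw_fun x u) (fun x y => tw_funD x y u) (tw_fun0 u)).
Qed.

Lemma tw_funX u v : tw_fun (X u) v = (v == u)%:R.
Proof. by rewrite /tw_fun ffunE. Qed.

Lemma tw_expand (x : A) : x = \sum_u tw_fun x u *: X u.
Proof.
apply: tw_funP => v; rewrite tw_fun_sum (bigD1 v) //= big1 => [|u /negPf nuv].
  by rewrite tw_funZ tw_funX eqxx mulr1 addr0.
by rewrite tw_funZ tw_funX eq_sym nuv mulr0.
Qed.

Lemma tw_mul_linl y : linear (tw_mul^~ y).
Proof.
move=> a x x'; rewrite /tw_mul scaler_sumr -big_split; apply: eq_bigr => u _ /=.
rewrite scaler_sumr -big_split; apply: eq_bigr => v _ /=.
by rewrite tw_funD tw_funZ scalerA -scalerDl !mulrDl !mulrA.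
Qed.

Lemma tw_mul_linr x : linear (tw_mul x).
Proof.
move=> a y y'; rewrite /tw_mul scaler_sumr -big_split; apply: eq_bigr => u _ /=.
rewrite scaler_sumr -big_split; apply: eq_bigr => v _ /=.
rewrite tw_funD tw_funZ scalerA -scalerDl mulrDr mulrDl !mulrA.
by rewrite [_ * a]mulrC.
Qed.

Lemma tw_mulDl : left_distributive tw_mul +%R.
Proof. by move=> x y z; have := tw_mul_linl z 1 x y; rewrite !scale1r. Qed.

Lemma tw_mulDr : right_distributive tw_mul +%R.
Proof. by move=> x y z; have := tw_mul_linr x 1 y z; rewrite !scale1r. Qed.

Lemma tw_mul0l y : tw_mul 0 y = 0.
Proof. by apply: (addrI (tw_mul 0 y)); rewrite -tw_mulDl !addr0. Qed.

Lemma tw_mul0r x : tw_mul x 0 = 0.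
Proof. by apply: (addrI (tw_mul x 0)); rewrite -tw_mulDr !addr0. Qed.

Lemma tw_mulZl a x y : tw_mul (a *: x) y = a *: tw_mul x y.
Proof. by have := tw_mul_linl y a x 0; rewrite tw_mul0l !addr0. Qed.

Lemma tw_mulZr a x y : tw_mul x (a *: y) = a *: tw_mul x y.
Proof. by have := tw_mul_linr x a y 0; rewrite tw_mul0r !addr0. Qed.

Lemma tw_linear_ext (f g : A -> A) :
  linear f -> linear g -> (forall u, f (X u) = g (X u)) -> f =1 g.
Proof.
move=> f_lin g_lin fg x.
pose fL := GRing.isLinear.Build F A A _ f f_lin.
pose gL := GRing.isLinear.Build F A A _ g g_lin.
pose f' : {linear A -> A} := HB.pack f fL.
pose g' : {linear A -> A} := HB.pack g gL.
rewrite -[f x]/(f' x) -[g x]/(g' x) (tw_expand x) !linear_sum.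
by apply: eq_bigr => u _; rewrite !linearZ /= fg.
Qed.

Lemma tw_mulX u v : tw_mul (X u) (X v) = sigma u v *: X (u * v)%g.
Proof.
rewrite /tw_mul (bigD1 u) //= [X in _ + X]big1 => [|u' /negPf nu]; last first.
  by rewrite big1 // => v' _; rewrite tw_funX nu !mul0r scale0r.
rewrite (bigD1 v) //= big1 => [|v' /negPf nv].
  by rewrite !tw_funX !eqxx !mul1r !addr0.
by rewrite !tw_funX nv mulr0 mul0r scale0r.
Qed.

Lemma tw_mulA : associative tw_mul.
Proof.
move=> x y z.
apply: (tw_linear_ext (f := fun x => tw_mul x (tw_mul y z))
                      (g := fun x => tw_mul (tw_mul x y) z)).
- by move=> a x1 x2; rewrite tw_mul_linl.
- by move=> a x1 x2; rewrite !tw_mul_linl.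
move=> u; apply: (tw_linear_ext (f := fun y => tw_mul (X u) (tw_mul y z))
                                (g := fun y => tw_mul (tw_mul (X u) y) z)).
- by move=> a y1 y2; rewrite tw_mul_linl tw_mul_linr.
- by move=> a y1 y2; rewrite tw_mul_linr tw_mul_linl.
move=> v; apply: (tw_linear_ext (f := fun z => tw_mul (X u) (tw_mul (X v) z))
                                (g := fun z => tw_mul (tw_mul (X u) (X v)) z)).
- by move=> a z1 z2; rewrite !tw_mul_linr.
- by move=> a z1 z2; rewrite tw_mul_linr.
move=> w; rewrite !tw_mulX tw_mulZr tw_mulZl !tw_mulX !scalerA mulgA.
by rewrite (cocycle2P sigma) mulrC.
Qed.

Lemma cocycle2_1l u : sigma 1%g u = sigma 1%g 1%g.
Proof.
have := cocycle2P sigma 1%g 1%g u; rewrite !mul1g => /eqP.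
by rewrite (inj_eq (mulIf (cocycle2_neq0 _ _ _))) => /eqP.
Qed.

Lemma cocycle2_1r u : sigma u 1%g = sigma 1%g 1%g.
Proof.
have := cocycle2P sigma u 1%g 1%g; rewrite !mulg1 => /eqP.
by rewrite (inj_eq (mulfI (cocycle2_neq0 _ _ _))) => /eqP.
Qed.

Lemma tw_mul1l : left_id tw_one tw_mul.
Proof.
apply: (tw_linear_ext (g := id)) => [||u] //; first exact: tw_mul_linr.
rewrite tw_mulZl tw_mulX mul1g cocycle2_1l scalerA.
by rewrite mulVf ?scale1r // cocycle2_neq0.
Qed.

Lemma tw_mul1r : right_id tw_one tw_mul.
Proof.
apply: (tw_linear_ext (g := id)) => [||u] //; first exact: tw_mul_linl.
rewrite tw_mulZr tw_mulX mulg1 cocycle2_1r scalerA.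
by rewrite mulVf ?scale1r // cocycle2_neq0.
Qed.

Lemma tw_one_neq0 : tw_one != 0.
Proof.
apply/eqP => /(congr1 (fun x => tw_fun x 1%g)) /eqP.
by rewrite tw_funZ tw_funX tw_fun0 eqxx mulr1 invr_eq0 (negPf (cocycle2_neq0 _ _ _)).
Qed.

HB.instance Definition _ := GRing.Zmodule_isNzRing.Build A
  tw_mulA tw_mul1l tw_mul1r tw_mulDl tw_mulDr tw_one_neq0.

Fact tw_scaleAl a (x y : A) : a *: (x * y) = a *: x * y.
Proof. by rewrite /GRing.mul /= tw_mulZl. Qed.

Fact tw_scaleAr a (x y : A) : a *: (x * y) = x * (a *: y).
Proof. by rewrite /GRing.mul /= tw_mulZr. Qed.

HB.instance Definition _ := GRing.Lmodule_isLalgebra.Build F A tw_scaleAl.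
HB.instance Definition _ := GRing.Lalgebra_isAlgebra.Build F A tw_scaleAr.
HB.instance Definition _ := Algebra_isFalgebra.Build F A.

Lemma tw_basisM u v : X u * X v = sigma u v *: X (u * v)%g.
Proof. exact: tw_mulX. Qed.

End TwistedGroupAlgebra.

Record group_grading (F : fieldType) (T : finGroupType) (A : falgType F) :=
  GroupGrading {
    gr_comp :> T -> {vspace A};
    gr_full : (\sum_g gr_comp g)%VS = fullv;
    gr_direct : directv (\sum_g gr_comp g);
    gr_mul : forall g h, (gr_comp g * gr_comp h <= gr_comp (g * h)%g)%VS
  }.

Section NaturalGrading.
Variables (F : fieldType) (T : finGroupType) (sigma : cocycle2 F T).
Local Notation A := (twisted_galg sigma).

Definition tw_comp (g : T) : {vspace A} := <[tw_basis sigma g]>%VS.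

Lemma tw_comp_full : (\sum_g tw_comp g)%VS = fullv.
Proof.
apply/eqP; rewrite eqEsubv subvf /=; apply/subvP => x _.
rewrite (tw_expand x); apply: memv_sumr => g _.
by rewrite memvZ // memv_line.
Qed.

Lemma tw_comp_direct : directv (\sum_g tw_comp g).
Proof.
apply/directv_sum_independent => us us_in us0 g _.
have [k usE] : exists k : T -> F, forall h, us h = k h *: tw_basis sigma h.
  have /fin_all_exists[k kE] h : exists a, us h = a *: tw_basis sigma h.
    by have /vlineP[a ->] := us_in h isT; exists a.
  by exists k.
have := congr1 (fun x : A => tw_fun x g) us0.
rewrite tw_fun_sum tw_fun0 (bigD1 g) //= big1 => [|h /negPf nhg].
  by rewrite usE tw_funZ tw_funX eqxx mulr1 addr0 => ->; rewrite scale0r.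
by rewrite usE tw_funZ tw_funX eq_sym nhg mulr0.
Qed.

Lemma tw_comp_mul g h : (tw_comp g * tw_comp h <= tw_comp (g * h)%g)%VS.
Proof.
apply/prodvP => _ _ /vlineP[a ->] /vlineP[b ->].
by rewrite -scalerAl -scalerAr tw_basisM !memvZ // memv_line.
Qed.

Definition natural_grading : group_grading T A :=
  GroupGrading tw_comp_full tw_comp_direct tw_comp_mul.

End NaturalGrading.

Definition is_involution (F : fieldType) (A : falgType F) (iota : A -> A) :=
  [/\ linear iota,
      forall x y, iota (x * y) = iota y * iota x
    & forall x, iota (iota x) = x].

Definition homogeneous_involution (F : fieldType) (T : finGroupType)
    (A : falgType F) (gr : group_grading T A) (tau : T -> T) (iota : A -> A) :=
  is_involution iota /\
  forall g x, x \in gr g -> iota x \in gr (tau g).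

Definition antiautomorphism (T : finGroupType) (tau : T -> T) :=
  bijective tau /\ forall u v, tau (u * v)%g = (tau v * tau u)%g.

Definition delta (F : fieldType) (T : finGroupType) (mu : T -> F) (u v : T) : F :=
  mu u * mu v * (mu (u * v)%g)^-1.

Definition cocycle_twist (F : fieldType) (T : finGroupType) (tau : T -> T)
  (sigma : T -> T -> F) (u v : T) : F := sigma (tau v) (tau u).

Definition compatible (F : fieldType) (T : finGroupType)
    (sigma : T -> T -> F) (tau : T -> T) :=
  exists mu : T -> F,
    [/\ forall u, mu u != 0,
        forall u v, sigma u v = delta mu u v * cocycle_twist tau sigma u v
      & forall u, mu (u * tau u)%g = 1].

(* Main.v *)
(** Homogeneity forces [iota (X u) = mu u *: X (tau u)] with [mu u] invertible.
    Comparing coefficients on basis elements, antimultiplicativity says exactly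
    that [tau] is antimultiplicative and that [sigma = delta mu * tau sigma],
    while involutivity says that [tau \o tau = id] and [mu u * mu (tau u) = 1].
    The condition [mu (u * tau u) = 1] holds since [X u * iota (X u)] is a fixed
    point of [iota]; conversely it yields [mu u * mu (tau u) = 1] by evaluating
    the cocycle identity at [(u, tau u)]. *)

Require Import Defs.
From mathcomp Require Import all_boot all_order all_algebra all_fingroup all_field.
Import GRing.Theory.
Local Open Scope ring_scope.

Section MonomialMaps.
Variables (F : fieldType) (T : finGroupType) (sigma : cocycle2 F T).
Local Notation A := (twisted_galg sigma).
Local Notation X := (tw_basis sigma).

(** Comparing coordinates at [u] settles both claims: if [v] differed from [u], the right side would
    vanish there, against [a != 0]. *)
Lemma tw_basisZ_inj a b u v : a != 0 -> a *: X u = b *: X v -> u = v /\ a = b.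
Proof.
move=> a0 /(congr1 (fun x : A => tw_fun x u)).
rewrite !tw_funZ !tw_funX eqxx mulr1; have [->|_] := eqVneq u v.
  by rewrite mulr1.
by rewrite mulr0 => aE; rewrite aE eqxx in a0.
Qed.

Lemma tw_basis_neq0 u : X u != 0.
Proof.
apply/eqP => /(congr1 (fun x : A => tw_fun x u)) /eqP.
by rewrite tw_funX tw_fun0 eqxx oner_eq0.
Qed.

Section ToMonomial.
Variables (tau : T -> T) (iota : A -> A).
Hypothesis iotaP : homogeneous_involution (natural_grading sigma) tau iota.

Lemma homogeneous_involutionZ a x : iota (a *: x) = a *: iota x.
Proof.
have [[iota_lin _ _] _] := iotaP.
have iota0 : iota 0 = 0.
  by have := iota_lin (-1) 0 0; rewrite scaler0 addr0 scaleN1r addNr.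
by have := iota_lin a x 0; rewrite iota0 !addr0.
Qed.

(** Each component of the grading is a line, which yields the scalar [mu u]; it is nonzero because
    [iota], being its own inverse, cannot kill [X u]. *)
Lemma homogeneous_involution_monomial :
  exists mu : T -> F,
    (forall u, mu u != 0) /\ forall u, iota (X u) = mu u *: X (tau u).
Proof.
have [[_ _ iotaK] iota_gr] := iotaP.
have /fin_all_exists[mu muE] u : exists a, iota (X u) = a *: X (tau u).
  by have /vlineP[a ->] := iota_gr u _ (memv_line (X u)); exists a.
exists mu; split=> // u; apply: contraNneq (tw_basis_neq0 u) => mu0.
by rewrite -(iotaK (X u)) muE mu0 homogeneous_involutionZ scale0r.
Qed.

Lemma homogeneous_involution_compatible :
  [/\ antiautomorphism tau, (forall u, tau (tau u) = u) & compatible sigma tau].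
Proof.
have [mu [mu0 muE]] := homogeneous_involution_monomial.
have iotaZ := homogeneous_involutionZ.
have [[_ iotaM iotaK] _] := iotaP.
have tauK u : tau (tau u) = u.
  have := iotaK (X u); rewrite muE iotaZ muE scalerA -[RHS]scale1r.
  by case/tw_basisZ_inj; rewrite ?mulf_neq0.
have sigma0 u v : sigma u v != 0 by exact: cocycle2_neq0.
(* Expanding [iota (X u * X v)] in two ways gives an equality of monomials: degrees give the first
   claim, coefficients the second. *)
have tauM u v : tau (u * v)%g = (tau v * tau u)%g /\
    sigma u v * mu (u * v)%g = mu v * mu u * sigma (tau v) (tau u).
  have := iotaM (X u) (X v).
  rewrite tw_basisM iotaZ !muE -scalerAl -scalerAr tw_basisM !scalerA.
  by apply: tw_basisZ_inj; rewrite mulf_neq0.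
split=> //; first by split=> [|u v]; [exists tau | case: (tauM u v)].
exists mu; split=> // [u v|u].
  rewrite /delta /cocycle_twist mulrAC [mu u * _]mulrC -(tauM u v).2.
  by rewrite mulfK.
(* The fixed point [X u * iota (X u)] is a nonzero multiple of [X (u * tau u)], and [iota] scales
   its coefficient by [mu (u * tau u)]. *)
have := iotaM (X u) (iota (X u)).
rewrite iotaK muE -scalerAr tw_basisM !iotaZ muE !scalerA.
case/tw_basisZ_inj => [|_ E]; first by rewrite !mulf_neq0.
have cN0 : mu u * sigma u (tau u) != 0 by rewrite mulf_neq0.
by apply: (mulfI cN0); rewrite E mulr1.
Qed.

End ToMonomial.

Section OfMonomial.
Variables (tau : T -> T) (mu : T -> F).

(** Candidate involution for the converse: the only linear map of the monomial form forced above. *)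
Definition tw_monomial (x : A) : A :=
  \sum_u tw_fun x u *: (mu u *: X (tau u)).

Lemma tw_monomial_linear : linear tw_monomial.
Proof.
move=> a x y; rewrite /tw_monomial scaler_sumr -big_split.
by apply: eq_bigr => u _ /=; rewrite tw_funD tw_funZ scalerDl !scalerA !mulrA.
Qed.

Lemma tw_monomialX u : tw_monomial (X u) = mu u *: X (tau u).
Proof.
rewrite /tw_monomial (bigD1 u) //= big1 => [|v /negPf nvu].
  by rewrite tw_funX eqxx scale1r addr0.
by rewrite tw_funX nvu scale0r.
Qed.

Lemma tw_monomialZ a x : tw_monomial (a *: x) = a *: tw_monomial x.
Proof.
rewrite /tw_monomial scaler_sumr; apply: eq_bigr => u _.
by rewrite tw_funZ !scalerA mulrA.
Qed.

Hypothesis tauM : forall u v, tau (u * v)%g = (tau v * tau u)%g.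
Hypothesis tauK : forall u, tau (tau u) = u.
Hypothesis mu_neq0 : forall u, mu u != 0.
Hypothesis sigmaE :
  forall u v, sigma u v = delta mu u v * cocycle_twist tau sigma u v.

(** Both sides are bilinear in [x] and [y], so basis elements suffice; there [sigmaE] matches the
    coefficients. *)
Lemma tw_monomialM (x y : A) :
  tw_monomial (x * y) = tw_monomial y * tw_monomial x.
Proof.
apply: (tw_linear_ext (f := fun x => tw_monomial (x * y))
                      (g := fun x => tw_monomial y * tw_monomial x)).
- by move=> a x1 x2; rewrite mulrDl -scalerAl tw_monomial_linear.
- by move=> a x1 x2; rewrite tw_monomial_linear mulrDr -scalerAr.
move=> u; apply: (tw_linear_ext (f := fun y => tw_monomial (X u * y))
                                (g := fun y => tw_monomial y * tw_monomial (X u))).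
- by move=> a y1 y2; rewrite mulrDr -scalerAr tw_monomial_linear.
- by move=> a y1 y2; rewrite tw_monomial_linear mulrDl -scalerAl.
move=> v; rewrite tw_basisM tw_monomialZ !tw_monomialX.
rewrite -scalerAl -scalerAr tw_basisM !scalerA tauM; congr (_ *: _).
by rewrite sigmaE /delta /cocycle_twist mulrAC divfK // [mu v * _]mulrC.
Qed.

Hypothesis mu_norm : forall u, mu (u * tau u)%g = 1.

(** At [(u, tau u)] the twisted cocycle takes the same value as [sigma], since [tau] swaps the two
    arguments; cancelling it leaves [delta mu u (tau u) = 1]. *)
Lemma mu_tauV u : mu u * mu (tau u) = 1.
Proof.
have := sigmaE u (tau u).
rewrite /delta /cocycle_twist mu_norm invr1 mulr1 tauK.
rewrite -[LHS]mul1r => /(mulIf (cocycle2_neq0 _ _ _)) E.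
by rewrite -E.
Qed.

Lemma tw_monomialK x : tw_monomial (tw_monomial x) = x.
Proof.
apply: (tw_linear_ext (f := fun x => tw_monomial (tw_monomial x)) (g := id)) => //.
  by move=> a y z; rewrite !tw_monomial_linear.
by move=> u; rewrite tw_monomialX tw_monomialZ tw_monomialX tauK scalerA
  mu_tauV scale1r.
Qed.

Lemma tw_monomial_homogeneous_involution :
  homogeneous_involution (natural_grading sigma) tau tw_monomial.
Proof.
split; first split.
- exact: tw_monomial_linear.
- exact: tw_monomialM.
- exact: tw_monomialK.
move=> g _ /vlineP[a ->]; rewrite tw_monomialZ tw_monomialX scalerA.
by rewrite memvZ // memv_line.
Qed.

End OfMonomial.

End MonomialMaps.

Theorem theorem4 (F : fieldType) (charF : 2%N \notin [pchar F])
    (T : finGroupType) (sigma : cocycle2 F T) (tau : T -> T) :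
  (exists iota : twisted_galg sigma -> twisted_galg sigma,
     homogeneous_involution (natural_grading sigma) tau iota) <->
  [/\ antiautomorphism tau, (forall u, tau (tau u) = u) & compatible sigma tau].
Proof.
split=> [[iota]|[[_ tauM] tauK [mu [mu0 sigmaE mu_norm]]]].
  exact: homogeneous_involution_compatible.
by exists (tw_monomial F T sigma tau mu); apply: tw_monomial_homogeneous_involution.
Qed.
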